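(* Let $\mathbb{K}$ be $\mathbb{R}$ or $\mathbb{C}$, let $1<p<\infty$, and let $q$ be the conjugate index of $p$, i.e. $\frac1p+\frac1q=1$. Let $\mathcal{X}$ be a finite dimensional Banach space over $\mathbb{K}$, and let $(\{f_j\}_{j=1}^n, \{\tau_j\}_{j=1}^n)$ and $(\{g_k\}_{k=1}^m, \{\omega_k\}_{k=1}^m)$ be p-Schauder frames for $\mathcal{X}$. Then for every $x \in \mathcal{X}\setminus\{0\}$, $$\|\theta_f x\|_0^{\frac{1}{p}}\,\|\theta_g x\|_0^{\frac{1}{q}} \geq \frac{1}{\displaystyle\max_{1\leq j\leq n,\, 1\leq k\leq m}|f_j(\omega_k)|}\quad \text{and} \quad \|\theta_g x\|_0^{\frac{1}{p}}\,\|\theta_f x\|_0^{\frac{1}{q}}\geq \frac{1}{\displaystyle\max_{1\leq j\leq n,\, 1\leq k\leq m}|g_k(\tau_j)|}.$$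
   Context: Let $\mathcal{X}^*$ denote the dual of $\mathcal{X}$. For $1<p<\infty$, a pair $(\{f_j\}_{j=1}^n, \{\tau_j\}_{j=1}^n)$, where $\{\tau_j\}_{j=1}^n$ is a collection in $\mathcal{X}$ and $\{f_j\}_{j=1}^n$ is a sequence in $\mathcal{X}^*$, is called a p-Schauder frame for $\mathcal{X}$ if the following two conditions hold: (i) for every $x \in \mathcal{X}$, $\|x\|^p=\sum_{j=1}^n|f_j(x)|^p$; (ii) for every $x \in \mathcal{X}$, $x=\sum_{j=1}^n f_j(x)\tau_j$. For $d\in\mathbb{N}$, $\ell^p([d])$ denotes $\mathbb{K}^d$ equipped with the standard $p$-norm. The maps $\theta_f$ and $\theta_g$ are defined by $$\theta_f: \mathcal{X} \ni x \mapsto (f_j(x))_{j=1}^n \in \ell^p([n]), \qquad \theta_g: \mathcal{X} \ni x \mapsto (g_k(x))_{k=1}^m \in \ell^p([m]).$$ For a vector $h\in\mathbb{K}^d$, $\|h\|_0$ denotes the number of nonzero entries of $h$. *)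

(* Defs.v *)
From HB Require Import structures.
From mathcomp Require Import all_boot all_order all_algebra.
From mathcomp Require Import complex.
From mathcomp Require Import boolp classical_sets reals topology normedtype exp.

Set Implicit Arguments.
Unset Strict Implicit.
Unset Printing Implicit Defensive.

Import Order.TTheory GRing.Theory Num.Theory.
Import numFieldNormedType.Exports.

Local Open Scope ring_scope.

Inductive scalar_kind := RealScalars | ComplexScalars.

Definition scalar_field (R : realType) (k : scalar_kind) : numFieldType :=
  match k with
  | RealScalars => (R : numFieldType)
  | ComplexScalars => (R[i] : numFieldType)
  end.

Definition scalar_Re (R : realType) (k : scalar_kind) :
    scalar_field R k -> R :=
  match k return scalar_field R k -> R with
  | RealScalars => fun a => a
  | ComplexScalars => fun a => complex.Re a
  end.

(* In a normed module over K the norm takes its values in K; over R[i] these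
   values have zero imaginary part, so taking real parts loses nothing. *)
Definition rnorm (R : realType) (k : scalar_kind)
    (V : normedModType (scalar_field R k)) (v : V) : R :=
  scalar_Re `|v|.

Record dual_space (K : numFieldType) (X : normedModType K) := DualSpace {
  dual_fun :> {linear X -> K^o};
  dual_continuous : continuous dual_fun
}.

Definition finite_dimensional (K : fieldType) (X : lmodType K) : Prop :=
  exists (d : nat) (phi : X -> 'rV[K]_d), linear phi /\ bijective phi.

Definition p_schauder_frame (R : realType) (k : scalar_kind) (p : R)
    (X : normedModType (scalar_field R k)) (n : nat)
    (f : 'I_n -> dual_space X) (tau : 'I_n -> X) : Prop :=
  (forall x : X, rnorm x `^ p = \sum_(j < n) rnorm (f j x) `^ p) /\
  (forall x : X, x = \sum_(j < n) (f j x : scalar_field R k) *: tau j).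

Definition analysis_map (K : numFieldType) (X : normedModType K) (n : nat)
    (f : 'I_n -> dual_space X) (x : X) : 'rV[K]_n :=
  \row_(j < n) f j x.

Definition norm0 (K : fieldType) (d : nat) (h : 'rV[K]_d) : nat :=
  #|[set i : 'I_d | h ord0 i != 0]|.

(* The values are nonnegative, so the default 0 affects only an empty index
   set, which cannot occur for frames of a nonzero space. *)
Definition max_abs (R : realType) (k : scalar_kind)
    (X : normedModType (scalar_field R k)) (n m : nat)
    (f : 'I_n -> dual_space X) (v : 'I_m -> X) : R :=
  \big[Num.max/0]_(j < n) \big[Num.max/0]_(i < m) rnorm (f j (v i)).

(* Main.v *)
(* Expanding [x] in the frame [(g, omega)] gives
   [|f_j x| <= M * \sum_k |g_k x|] with [M = max |f_j (omega_k)|].  Only the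
   [k] in the support of [theta_g x] contribute, so Hoelder's inequality bounds
   the sum by [||x|| * ||theta_g x||_0^(1/q)].  Taking [p]-th powers, summing
   over the support of [theta_f x] and cancelling [||x||] yields
   [1 <= M * ||theta_f x||_0^(1/p) * ||theta_g x||_0^(1/q)]. *)
Require Import Defs.
From mathcomp Require Import all_boot all_order all_algebra.
From mathcomp Require Import complex.
From mathcomp Require Import boolp classical_sets reals topology normedtype exp.

Import Order.TTheory GRing.Theory Num.Theory.
Import numFieldNormedType.Exports.

Local Open Scope ring_scope.

Lemma scalar_ReD (R : realType) (k : scalar_kind) (a b : scalar_field R k) :
  scalar_Re (a + b) = scalar_Re a + scalar_Re b.
Proof. by case: k a b => //= [[a1 a2] [b1 b2]]. Qed.

Lemma scalar_Re_ge0 (R : realType) (k : scalar_kind) (a : scalar_field R k) :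
  0 <= a -> 0 <= scalar_Re a.
Proof. by case: k a => //= [[a1 a2]]; rewrite lecE => /andP[]. Qed.

Lemma scalar_Re_gt0 (R : realType) (k : scalar_kind) (a : scalar_field R k) :
  0 < a -> 0 < scalar_Re a.
Proof. by case: k a => //= [[a1 a2]]; rewrite ltcE => /andP[]. Qed.

(** A nonnegative complex number has zero imaginary part, so the cross term of the product
    disappears. This makes [rnorm] absolutely homogeneous. *)
Lemma scalar_ReM (R : realType) (k : scalar_kind) (a b : scalar_field R k) :
  0 <= a -> scalar_Re (a * b) = scalar_Re a * scalar_Re b.
Proof.
case: k a b => //= [[a1 a2] [b1 b2]]; rewrite lecE => /andP[/= /eqP-> _].
by rewrite mul0r subr0.
Qed.

Lemma le_scalar_Re (R : realType) (k : scalar_kind) (a b : scalar_field R k) :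
  a <= b -> scalar_Re a <= scalar_Re b.
Proof. by case: k a b => //= [[a1 a2] [b1 b2]]; rewrite lecE => /andP[]. Qed.

Section RealNorm.
Variables (R : realType) (k : scalar_kind).
Variable V : normedModType (scalar_field R k).

Lemma rnorm_ge0 (v : V) : 0 <= rnorm v.
Proof. exact/scalar_Re_ge0/normr_ge0. Qed.

Lemma rnorm0 : rnorm (0 : V) = 0.
Proof. by rewrite /rnorm normr0; case: k. Qed.

Lemma rnorm_gt0 (v : V) : v != 0 -> 0 < rnorm v.
Proof. by rewrite -normr_gt0 => /scalar_Re_gt0. Qed.

Lemma ler_rnormD (v w : V) : rnorm (v + w) <= rnorm v + rnorm w.
Proof. by rewrite -scalar_ReD; exact/le_scalar_Re/ler_normD. Qed.

Lemma ler_rnorm_sum (I : finType) (F : I -> V) :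
  rnorm (\sum_i F i) <= \sum_i rnorm (F i).
Proof.
elim/big_ind2: _ => [|r v s w vr ws|//]; first by rewrite rnorm0.
exact: le_trans (ler_rnormD _ _) (lerD vr ws).
Qed.

Lemma rnormZ (a : scalar_field R k) (v : V) :
  rnorm (a *: v) = rnorm (a : (scalar_field R k)^o) * rnorm v.
Proof. by rewrite /rnorm normrZ scalar_ReM. Qed.

End RealNorm.

Lemma rnorm_le_max_abs (R : realType) (k : scalar_kind)
    (X : normedModType (scalar_field R k)) (n m : nat)
    (f : 'I_n -> dual_space X) (v : 'I_m -> X) (j : 'I_n) (i : 'I_m) :
  rnorm (f j (v i)) <= max_abs f v.
Proof.
rewrite /max_abs; apply: le_trans (le_bigmax _ _ j).
exact: (le_bigmax _ (fun i => rnorm (f j (v i)))).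
Qed.

Lemma norm0_analysis_map (R : realType) (k : scalar_kind)
    (X : normedModType (scalar_field R k)) (n : nat)
    (f : 'I_n -> dual_space X) (x : X) :
  norm0 (analysis_map f x) = #|[set j | rnorm (f j x) != 0]|.
Proof.
apply: eq_card => j; rewrite !inE mxE; congr (~~ _).
have [->|fx0] := eqVneq (f j x : scalar_field R k) 0.
  by rewrite rnorm0 eqxx.
by rewrite gt_eqF// rnorm_gt0.
Qed.

(** Hoelder's inequality for [a] against the indicator of its support, whose [q]-norm is the
    cardinality to the power [1/q]; [t] is the [p]-norm of [a]. *)
Lemma sum_le_support_holder (R : realType) (I : finType) (p q t : R)
    (a : I -> R) :
  0 < p -> 0 < q -> p^-1 + q^-1 = 1 -> 0 < t -> (forall i, 0 <= a i) ->
  t `^ p = \sum_i a i `^ p ->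
  \sum_i a i <= t * #|[set i | a i != 0]|%:R `^ q^-1.
Proof.
move=> p0 q0 pq t0 a0 ta; set S := [set i | a i != 0].
have sumS (F : R -> R) : F 0 = 0 -> \sum_i F (a i) = \sum_(i in S) F (a i).
  move=> F0; rewrite [LHS](bigID (mem S))/= [X in _ + X]big1 ?addr0// => i.
  by rewrite inE negbK => /eqP->.
(* An empty support is treated apart, since the normalisation below divides by [c]. *)
have [S0|S0] := posnP #|S|.
  rewrite (sumS id)// big1; first by rewrite mulr_ge0 ?powR_ge0// ltW.
  by move=> i; rewrite (cards0_eq S0) inE.
set c := #|S|%:R `^ q^-1.
have N0 : 0 < #|S|%:R :> R by rewrite ltr0n.
have c0 : 0 < c by rewrite powR_gt0.
have tc0 : 0 < t * c by rewrite mulr_gt0.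
rewrite -[leRHS]mul1r -ler_pdivrMr// -pq (sumS id)// mulr_suml.
(* Young's inequality, with [c] chosen so that the bounds sum to [1 / p + 1 / q]. *)
have young i : a i / (t * c) <= (a i / t) `^ p / p + c^-1 `^ q / q.
  rewrite invfM mulrA; apply: conjugate_powR => //.
    by rewrite mulr_ge0// invr_ge0 ltW.
  by rewrite invr_ge0 ltW.
apply: le_trans (ler_sum _ (fun i _ => young i)) _.
(* The first terms add up to [1/p] because [a / t] has [p]-norm 1, the second ones to [1/q] because
   [c] to the power [q] is [#|S|]. *)
rewrite big_split/= -mulr_suml lerD//.
  rewrite ler_pdivrMr// mulVf ?gt_eqF//.
  have tV0 : 0 <= t^-1 by rewrite invr_ge0 ltW.
  rewrite -(sumS (fun b => (b / t) `^ p)) ?mul0r ?powR0 ?gt_eqF//.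
  under eq_bigr do rewrite powRM//.
  by rewrite -mulr_suml -ta -powRM ?divff ?powR1 ?gt_eqF// ltW.
rewrite sumr_const -mulr_natl mulrA ler_pdivrMr// mulVf ?gt_eqF//.
rewrite -(powR_inv1 (ltW c0)) /c -!powRrM mulN1r mulrN mulVf ?gt_eqF//.
by rewrite powR_inv1 ?ler0n// divff// gt_eqF.
Qed.

Lemma frame_support_bound (R : realType) (k : scalar_kind) (p q : R)
    (X : normedModType (scalar_field R k)) (n m : nat)
    (f : 'I_n -> dual_space X) (tau : 'I_n -> X)
    (g : 'I_m -> dual_space X) (omega : 'I_m -> X) (x : X) :
  0 < p -> 0 < q -> p^-1 + q^-1 = 1 ->
  p_schauder_frame p f tau -> p_schauder_frame p g omega -> x != 0 ->
  (norm0 (analysis_map f x))%:R `^ (1 / p)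
    * (norm0 (analysis_map g x))%:R `^ (1 / q) >= 1 / max_abs f omega.
Proof.
move=> p0 q0 pq [fnorm _] [gnorm grec] x0; rewrite !norm0_analysis_map !div1r.
set S := [set j | rnorm (f j x) != 0]; set T := [set j | rnorm (g j x) != 0].
set M := max_abs f omega; set c := #|T|%:R `^ q^-1.
have nx0 : 0 < rnorm x by exact: rnorm_gt0.
have c0 : 0 <= c by exact: powR_ge0.
(* Here [M^-1 <= 0], with the convention that 0 has inverse 0, so the bound is trivial; afterwards
   division by [M] is legitimate. *)
have [M0|M0] := leP M 0.
  by apply: (@le_trans _ _ 0); rewrite ?invr_le0// mulr_ge0 ?powR_ge0.
have fx j : rnorm (f j x) <= M * (rnorm x * c).
  rewrite {1}[x]grec linear_sum; apply: le_trans (ler_rnorm_sum _ _ _ _ _) _.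
  have /(ler_wpM2l (ltW M0)) := sum_le_support_holder _ _ _ _ _ _ p0 q0 pq nx0
    (fun i => rnorm_ge0 _ _ _ (g i x)) (gnorm x).
  apply: le_trans; rewrite mulr_sumr; apply: ler_sum => i _.
  by rewrite linearZ rnormZ mulrC ler_wpM2r ?rnorm_ge0 ?rnorm_le_max_abs.
have B0 : 0 <= M * (rnorm x * c) by rewrite !mulr_ge0// ltW.
(* Indices outside [S] contribute 0 to the norm identity of [f], as [p] is nonzero; each of the
   others is bounded by [fx]. *)
have main : rnorm x `^ p <= #|S|%:R * (M * (rnorm x * c)) `^ p.
  rewrite fnorm (bigID (mem S))/= [X in _ + X]big1 ?addr0; last first.
    by move=> j; rewrite inE negbK => /eqP->; rewrite powR0 ?gt_eqF.
  rewrite mulr_natl -sumr_const; apply: ler_sum => j _.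
  by rewrite ge0_ler_powR ?nnegrE ?rnorm_ge0 ?(ltW p0).
have powpK (r : R) : 0 <= r -> (r `^ p) `^ p^-1 = r.
  by move=> r0; rewrite -powRrM divff ?gt_eqF// powRr1.
have : rnorm x <= #|S|%:R `^ p^-1 * (M * (rnorm x * c)).
  rewrite -{1}(powpK _ (ltW nx0)) -(powpK _ B0) -powRM ?powR_ge0//.
  by rewrite ge0_ler_powR ?nnegrE ?invr_ge0 ?mulr_ge0 ?powR_ge0// ltW.
(* Both sides are brought to the form [rnorm x] times a factor, and [rnorm x] is cancelled. *)
rewrite -[leLHS]mulr1 [X in _ <= _ * (M * X)]mulrC !mulrA [leRHS]mulrC.
rewrite ler_pM2l// => main1.
by rewrite -[leLHS]mul1r ler_pdivrMr// mulrAC.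
Qed.

Theorem theorem2p3 (R : realType) (k : scalar_kind) (p q : R)
    (p_gt1 : 1 < p) (pq_conj : 1 / p + 1 / q = 1)
    (X : completeNormedModType (scalar_field R k))
    (X_fin : finite_dimensional X)
    (n m : nat)
    (f : 'I_n -> dual_space X) (tau : 'I_n -> X)
    (g : 'I_m -> dual_space X) (omega : 'I_m -> X)
    (f_frame : p_schauder_frame p f tau)
    (g_frame : p_schauder_frame p g omega)
    (x : X) (x_neq0 : x != 0) :
  (norm0 (analysis_map f x))%:R `^ (1 / p)
    * (norm0 (analysis_map g x))%:R `^ (1 / q) >= 1 / max_abs f omega
  /\
  (norm0 (analysis_map g x))%:R `^ (1 / p)
    * (norm0 (analysis_map f x))%:R `^ (1 / q) >= 1 / max_abs g tau.
Proof.
have p0 : 0 < p by exact: lt_trans p_gt1.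
have pq : p^-1 + q^-1 = 1 by move: pq_conj; rewrite !div1r.
(* Since [p > 1], [1/q = 1 - 1/p] is positive. *)
have q0 : 0 < q.
  rewrite -invr_gt0 (_ : q^-1 = 1 - p^-1); last by rewrite -pq addrC addKr.
  by rewrite subr_gt0 invf_lt1.
(* The second inequality is the first with the two frames exchanged. *)
by split; [exact: frame_support_bound f_frame g_frame x_neq0
          |exact: frame_support_bound g_frame f_frame x_neq0].
Qed.
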